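(* Let $k\ge 2$, and let $m$ and $u$ be positive integers. Let $\vec b=(b_0,b_1,\dots)$ and $\vec c=(c_0,c_1,\dots)$ be infinite sequences of integers. Then the sequence $\{\widehat{C}^{\vec b,\vec c}_{k,u,n} \bmod m\}_{n\ge 0}$ is eventually periodic.
   Context: A $k$-dimensional balanced ballot path of length $kn$ is a sequence $P=(\vec s_1,\dots,\vec s_{kn})$ of standard unit vectors of $\mathbb{R}^k$ in which each $\vec e_i$ occurs exactly $n$ times and every intermediate point $\vec v_i=\sum_{j=1}^i\vec s_j$ ($0\le i\le kn$), $\vec x=(x_1,\dots,x_k)$, satisfies $x_1\ge\cdots\ge x_k$. The semisymmetric height of $\vec x\in\mathbb{Z}^k_{\ge 0}$ is $g_k(\vec x)=\sum_{i=1}^k(k+1-2i)x_i$; the semisymmetric height $g_k(P)$ of a path is the maximum of $g_k$ over its intermediate points (the empty path has height $0$). A step $\vec e_i$ is a semisymmetric up-step if $i\le\lfloor k/2\rfloor$; all other steps (down-steps $\vec e_j$ with $j\ge k-\lfloor k/2\rfloor+1$, and for odd $k$ the neutral step $\vec e_{\lfloor k/2\rfloor+1}$) are non-up-steps. The semisymmetric weight of $P$ is $sswt_{\vec b,\vec c}(P)=\prod b_{u_i}\cdot\prod c_{u'_j}$, where the first product runs over the up-steps of $P$ and $u_i$ is the semisymmetric height of the starting point of the $i$-th up-step, and the second product runs over the non-up-steps of $P$ and $u'_j$ is the semisymmetric height of the resulting point of the $j$-th non-up-step. Define $\widehat{C}^{\vec b,\vec c}_{k,u,n}=\sum_P sswt_{\vec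 b,\vec c}(P)$, the sum over all $k$-dimensional balanced ballot paths $P$ of length $kn$ with $g_k(P)\le u$. *)

(* Defs.v *)
From mathcomp Require Export all_boot all_order all_algebra.
Set Implicit Arguments.
Unset Strict Implicit.
Unset Printing Implicit Defensive.
Import Order.TTheory GRing.Theory Num.Theory.
Local Open Scope ring_scope.

(* A path is given by the indices of its steps: the entry i : 'I_k stands for
   the unit vector delta_mx 0 i. Indices start at 0, so i is e_(i+1). *)
Definition point_after (k d : nat) (P : d.-tuple 'I_k) (j : nat) : 'rV[int]_k :=
  \sum_(s <- take j P) delta_mx 0 s.

Definition balanced (k n : nat) (P : (k * n).-tuple 'I_k) : bool :=
  [forall i : 'I_k, count_mem i P == n].

Definition ballot (k d : nat) (P : d.-tuple 'I_k) : bool :=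
  [forall j : 'I_d.+1, forall i1 : 'I_k, forall i2 : 'I_k,
     (i1 <= i2)%N ==> (point_after P j 0 i2 <= point_after P j 0 i1)].

(* k + 1 - 2 i for 1 <= i <= k becomes k + 1 - 2 (i + 1) for i : 'I_k. *)
Definition ss_height (k : nat) (x : 'rV[int]_k) : int :=
  \sum_(i < k) (k%:Z + 1 - 2 * i.+1%:Z) * x 0 i.

(* The base value 0 of the maximum is the height of the starting point, which
   is among the points. *)
Definition ss_path_height (k d : nat) (P : d.-tuple 'I_k) : int :=
  \big[Num.max/0]_(j < d.+1) ss_height (point_after P j).

Definition ss_up (k : nat) (i : 'I_k) : bool := (i.+1 <= k %/ 2)%N.

(* The height of a point x_1 >= ... >= x_k is the sum of x_i - x_j over i < j,
   hence nonnegative, so that on ballot paths the absolute values below only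
   turn a height into a natural number index. *)
Definition sswt (b c : nat -> int) (k d : nat) (P : d.-tuple 'I_k) : int :=
  (\prod_(j < d | ss_up (tnth P j)) b `|ss_height (point_after P j)|%N) *
  (\prod_(j < d | ~~ ss_up (tnth P j)) c `|ss_height (point_after P j.+1)|%N).

Definition Chat (b c : nat -> int) (k u n : nat) : int :=
  \sum_(P : (k * n).-tuple 'I_k
        | [&& balanced P, ballot P & ss_path_height P <= u%:Z])
     sswt b c P.

Definition eventually_periodic (T : Type) (a : nat -> T) : Prop :=
  exists N p : nat, (0 < p)%N /\ forall n : nat, (N <= n)%N -> a (n + p)%N = a n.

(* Main.v *)
Require Import Defs.
From mathcomp Require Import all_boot all_order all_algebra.
From mathcomp Require Import ring zify.
Set Implicit Arguments.
Unset Strict Implicit.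
Unset Printing Implicit Defensive.
Import Order.TTheory GRing.Theory Num.Theory.
Local Open Scope ring_scope.

(** Transfer-operator argument. Heights, weights and the ballot condition only
    depend on a point up to translation by a multiple of (1, ..., 1), and a
    ballot point of height at most u has coordinate differences at most 2 u; so
    up to translation only finitely many points are visited. Let F l x be the
    weighted count of the admissible walks of length l from x to the diagonal.
    Modulo m the function F l lives in a finite set and F (l+1) is a function
    of F l, so l |-> F l mod m is eventually periodic; and the Chat of length
    k n is F (k n) 0. *)

(** Pigeonhole: two of the first [#|T|.+1] values agree, and since each value determines the next,
    the coincidence propagates. *)
Lemma eventually_periodic_finite (T : finType) (G : nat -> T) :
  (forall i j, G i = G j -> G i.+1 = G j.+1) -> eventually_periodic G.
Proof.
move=> GS.
have /injectivePn[i [j neq_ij eqG]] :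
    ~~ injectiveb (fun i : 'I_#|T|.+1 => G i).
  apply/negP => /injectiveP /leq_card; rewrite card_ord; lia.
wlog lt_ij : i j neq_ij eqG / (i < j)%N.
  move=> W; case: (ltngtP i j) => [/W|/W|/ord_inj eq_ij]; first exact.
    by apply; rewrite // eq_sym.
  by rewrite eq_ij eqxx in neq_ij.
exists (nat_of_ord i), (j - i)%N; split; first by lia.
move=> n /subnKC <-; elim: (n - i)%N => [|d IHd].
  by rewrite addn0 subnKC // ltnW.
by rewrite addnS addSn; apply: GS.
Qed.

Section Walks.

Variables (b c : nat -> int) (k u : nat).

Implicit Types (x : 'rV[int]_k) (s : seq 'I_k).

Definition admissible x : bool :=
  [forall i1 : 'I_k, forall i2 : 'I_k, (i1 <= i2)%N ==> (x 0 i2 <= x 0 i1)]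
  && (ss_height x <= u%:Z).

(** This replaces the endpoint [(n, ..., n)] by a condition invariant under translation; the length
    of a walk from 0 recovers [n]. *)
Definition diagonal x : bool := [forall i, forall j, x 0 i == x 0 j].

Definition step_weight x (i : 'I_k) : int :=
  if ss_up i then b `|ss_height x|%N
  else c `|ss_height (x + delta_mx 0 i)%R|%N.

Fixpoint admissible_walk x s : bool :=
  admissible x &&
  if s is i :: s' then admissible_walk (x + delta_mx 0 i) s' else diagonal x.

Fixpoint walk_weight x s : int :=
  if s is i :: s' then step_weight x i * walk_weight (x + delta_mx 0 i) s'
  else 1.

Definition walk_sum l x : int :=
  \sum_(P : l.-tuple 'I_k | admissible_walk x P) walk_weight x P.

(** * Invariance under translation along the diagonal *)

(** Reversing the indices negates the coefficients, so adding the reversed sum leaves only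
    coordinate differences. This yields both the translation invariance and the bound on
    differences. *)
Lemma ss_height_pair x :
  2 * ss_height x =
  \sum_(i < k) (k%:Z + 1 - 2 * i.+1%:Z) * (x 0 i - x 0 (rev_ord i)).
Proof.
under [RHS]eq_bigr do rewrite mulrBr.
rewrite big_split /= mulrDl mul1r {1}/ss_height; congr (_ + _).
rewrite /ss_height (reindex_inj rev_ord_inj) /=.
apply: eq_bigr => i _; have := ltn_ord i => ltik.
have -> : (k - i.+1).+1%:Z = k%:Z - i%:Z by lia.
have -> : i.+1%:Z = i%:Z + 1 by lia.
ring.
Qed.

Lemma ss_height_diag x a : ss_height (x + const_mx a) = ss_height x.
Proof.
apply: (@mulfI _ (2 : int)) => //; rewrite !ss_height_pair.
by apply: eq_bigr => i _; rewrite !mxE; congr (_ * _); ring.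
Qed.

Lemma admissible_diag x a : admissible (x + const_mx a) = admissible x.
Proof.
rewrite /admissible ss_height_diag; congr (_ && _).
by apply: eq_forallb => i; apply: eq_forallb => j; rewrite !mxE lerD2r.
Qed.

Lemma diagonal_diag x a : diagonal (x + const_mx a) = diagonal x.
Proof.
by apply: eq_forallb => i; apply: eq_forallb => j; rewrite !mxE (inj_eq (addIr _)).
Qed.

Lemma admissible_walk_diag x a s :
  admissible_walk (x + const_mx a) s = admissible_walk x s.
Proof.
elim: s x => [|i s IHs] x /=; rewrite admissible_diag ?diagonal_diag //.
by rewrite addrAC IHs.
Qed.

Lemma walk_weight_diag x a s : walk_weight (x + const_mx a) s = walk_weight x s.
Proof.
elim: s x => [|i s IHs] x //=.
by rewrite /step_weight addrAC IHs !ss_height_diag.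
Qed.

Lemma walk_sum_diag l x a : walk_sum l (x + const_mx a) = walk_sum l x.
Proof.
by apply: eq_big => P; rewrite ?admissible_walk_diag ?walk_weight_diag.
Qed.

(** * The recursion in the length *)

Lemma walk_sumS l x :
  walk_sum l.+1 x =
  if admissible x
  then \sum_(i < k) step_weight x i * walk_sum l (x + delta_mx 0 i) else 0.
Proof.
rewrite /walk_sum.
under [in RHS]eq_bigr do rewrite big_distrr /=.
rewrite pair_big_dep /=.
rewrite (reindex (fun p : 'I_k * l.-tuple 'I_k => [tuple of p.1 :: p.2])) /=.
  by case: ifP => adm; [apply: eq_bigl | rewrite big_pred0].
exists (fun P : l.+1.-tuple 'I_k => (thead P, [tuple of behead P])) => /=.
  by case=> i P _ /=; congr (_, _); apply: val_inj.
by move=> P _; rewrite [RHS]tuple_eta.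
Qed.

(** The starting point is tested even for the empty walk, so only admissible points need to be
    tracked. *)
Lemma walk_sum_inadmissible l x : ~~ admissible x -> walk_sum l x = 0.
Proof.
move=> /negbTE nadm; rewrite /walk_sum big_pred0 // => -[[|i s] szs] /=;
by rewrite nadm.
Qed.

(** * Comparison with Chat *)

Definition walk_point x s j := x + \sum_(t <- take j s) delta_mx 0 t.

Lemma admissible_walkP x s :
  reflect ((forall j, (j <= size s)%N -> admissible (walk_point x s j))
           /\ diagonal (walk_point x s (size s)))
          (admissible_walk x s).
Proof.
rewrite /walk_point; elim: s x => [|i s IHs] x /=.
  rewrite big_nil addr0; apply: (iffP andP) => [[adm dia]|[adm dia]].
    by split.
  by split=> //; apply: (adm 0%N).
rewrite big_cons addrA.
apply: (iffP andP) => [[adm /IHs[admS dia]]|[adm dia]].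
  split=> // -[|j] le_j; first by rewrite take0 big_nil addr0.
  by rewrite big_cons addrA; apply: admS.
split; first by have := adm 0%N isT; rewrite take0 big_nil addr0.
apply/IHs; split=> // j le_j.
by have := adm j.+1 le_j; rewrite big_cons addrA.
Qed.

Lemma walk_weightE d x (P : d.-tuple 'I_k) :
  walk_weight x P = \prod_(j < d) step_weight (walk_point x P j) (tnth P j).
Proof.
rewrite /walk_point; elim: d x P => [|d IHd] x P.
  by rewrite tuple0 big_ord0.
case/tupleP: P => i P; rewrite big_ord_recl /= IHd big_nil addr0 tnth0.
by congr (_ * _); apply: eq_bigr => j _; rewrite tnthS big_cons addrA.
Qed.

Lemma point_after_walk d (P : d.-tuple 'I_k) j :
  point_after P j = walk_point 0 P j.
Proof. by rewrite /walk_point add0r. Qed.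

Lemma point_afterS d (P : d.-tuple 'I_k) (j : 'I_d) :
  point_after P j.+1 = point_after P j + delta_mx 0 (tnth P j).
Proof.
rewrite /point_after (take_nth (tnth P j)) ?size_tuple //.
by rewrite -(tnth_nth (tnth P j)) -cats1 big_cat big_seq1.
Qed.

Lemma sswt_walk_weight d (P : d.-tuple 'I_k) : sswt b c P = walk_weight 0 P.
Proof.
rewrite walk_weightE /sswt [X in X * _]big_mkcond [X in _ * X]big_mkcond.
rewrite -big_split /=; apply: eq_bigr => j _; rewrite point_afterS.
rewrite -point_after_walk /step_weight.
by case: (ss_up _); rewrite /= (mulr1, mul1r).
Qed.

Lemma point_after_count d (P : d.-tuple 'I_k) i :
  point_after P d 0 i = (count_mem i P)%:Z.
Proof.
rewrite /point_after take_oversize ?size_tuple // summxE.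
under eq_bigr do rewrite mxE /=.
elim: (tval P) => [|t s IHs]; first by rewrite big_nil.
rewrite big_cons IHs /= eq_sym; lia.
Qed.

Lemma balanced_diagonal n (P : (k * n).-tuple 'I_k) :
  balanced P = diagonal (point_after P (k * n)).
Proof.
apply/forallP/forallP => [bal i|dia i].
  apply/forallP=> j; rewrite !point_after_count.
  by rewrite (eqP (bal i)) (eqP (bal j)).
have cnt j : count_mem j P = count_mem i P.
  by have /forallP/(_ j) := dia i; rewrite !point_after_count => /eqP[].
(* The [k] equal counts add up to the length [k * n]; cancelling [k], positive because [i : 'I_k]
   exists, makes each of them [n]. *)
have : (\sum_(j < k) count_mem j P = k * n)%N.
  rewrite -[RHS](size_tuple P); elim: (tval P) => [|t s IHs] /=.
    by rewrite big1.
  rewrite big_split /= IHs (bigD1 t) //= eqxx big1 ?addn0 ?add1n // => j.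
  by rewrite eq_sym => /negbTE->.
under eq_bigr do rewrite cnt.
rewrite sum_nat_const card_ord => /eqP; rewrite eqn_pmul2l //.
exact: leq_trans (ltn_ord i).
Qed.

Lemma Chat_walk_sum n : Chat b c k u n = walk_sum (k * n) 0.
Proof.
apply: eq_big => [P|P _]; last exact: sswt_walk_weight.
apply/and3P/admissible_walkP; rewrite size_tuple => -[].
  rewrite balanced_diagonal => dia /forallP ball /bigmax_leP[_ hgt].
  rewrite -point_after_walk; split=> // j le_j.
  rewrite -point_after_walk; apply/andP; split.
    exact: (ball (Ordinal (le_j : j < (k * n).+1)%N)).
  exact: (hgt (Ordinal (le_j : j < (k * n).+1)%N)).
move=> adm; rewrite -point_after_walk => dia; split.
- by rewrite balanced_diagonal.
- apply/forallP => j; have := adm j (ltn_ord j).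
  by rewrite -point_after_walk => /andP[].
- apply/bigmax_leP; split=> // j _; have := adm j (ltn_ord j).
  by rewrite -point_after_walk => /andP[].
Qed.

End Walks.

(** * Finiteness modulo translation and modulo m *)

Definition row_of_ffun k w (f : {ffun 'I_k -> 'I_w}) : 'rV[int]_k :=
  \row_i (f i : nat)%:Z.

(* In [ss_height_pair] all terms are nonnegative; the one of index 0 already
   bounds the largest difference. *)
Lemma admissible_bounded k u (x : 'rV[int]_k.+2) :
  admissible u x -> x 0 ord0 - x 0 ord_max <= (2 * u)%:Z.
Proof.
move=> /andP[/forallP dec hgt].
have le_x (i j : 'I_k.+2) : (i <= j)%N -> x 0 j <= x 0 i.
  by have /forallP/(_ j)/implyP := dec i.
have := ss_height_pair x; rewrite (bigD1 ord0) //= => hE.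
have rev0 : rev_ord ord0 = ord_max :> 'I_k.+2 by apply: val_inj => /=; lia.
move: hE; rewrite rev0.
set r := (\sum_(i < _ | _) _).
(* In the first half of the indices the coefficient and the difference are both nonnegative, in the
   second half both nonpositive. *)
have r_ge0 : 0 <= r.
  apply: sumr_ge0 => i _; have := ltn_ord i => lt_i.
  case: (leqP i (rev_ord i)) => /= le_i.
    by have := le_x i (rev_ord i) le_i => /= ?; apply: mulr_ge0; lia.
  have := le_x (rev_ord i) i (ltnW le_i) => /= ?.
  by apply: mulr_le0; lia.
have := le_x ord0 ord_max isT.
(* The leading coefficient [k + 1] is at least 1, so the difference is at most twice the height. *)
have -> : k.+2%:Z + 1 - 2 * 1%:Z = k%:Z + 1 by lia.
nia.
Qed.

Lemma admissible_normalize k u (x : 'rV[int]_k.+2) :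
  admissible u x ->
  exists (f : {ffun 'I_k.+2 -> 'I_(2 * u).+1}) a,
    x = row_of_ffun f + const_mx a.
Proof.
move=> adm; have bnd := admissible_bounded adm.
case/andP: adm => /forallP dec _.
(* Subtracting the last coordinate, which is the smallest, leaves entries between 0 and [2 * u]. *)
exists [ffun i => inord `|(x 0 i - x 0 ord_max)%R|%N], (x 0 ord_max).
apply/rowP => i; rewrite !mxE ffunE.
have /forallP/(_ i)/implyP/(_ isT) := dec ord0.
have /forallP/(_ ord_max)/implyP/(_ (ltn_ord i)) := dec i.
by move=> ? ?; rewrite inordK; lia.
Qed.

Section Residues.

Variables (b c : nat -> int) (k u m : nat).

Definition residues l :
    {ffun {ffun 'I_k.+2 -> 'I_(2 * u).+1} -> 'I_m.+1} :=
  [ffun f => inord `|(walk_sum b c u l (row_of_ffun f) %% m.+1)%Z|%N].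

(** The finite table controls all points: an admissible one is a translate of a tabulated row, and
    any other has walk sum 0. *)
Lemma residuesP l l' (x : 'rV[int]_k.+2) :
  residues l = residues l' ->
  (walk_sum b c u l x = walk_sum b c u l' x %[mod m.+1])%Z.
Proof.
move=> eq_ll'; case: (boolP (admissible u x)) => [adm|nadm]; last first.
  by rewrite !walk_sum_inadmissible.
have [f [a ->]] := admissible_normalize adm; rewrite !walk_sum_diag.
have := congr1 (fun g : {ffun _ -> _} => val (g f)) eq_ll'; rewrite !ffunE /=.
set y := walk_sum _ _ _ _ _; set z := walk_sum _ _ _ _ _.
have := modz_ge0 y (isT : m.+1%:Z != 0); have := ltz_pmod y (isT : 0 < m.+1%:Z).
have := modz_ge0 z (isT : m.+1%:Z != 0); have := ltz_pmod z (isT : 0 < m.+1%:Z).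
move=> ? ? ? ?; rewrite !inordK; lia.
Qed.

(** The recursion is linear with coefficients independent of [l]; neighbours outside the table are
    covered by [residuesP]. *)
Lemma residuesS l l' :
  residues l = residues l' -> residues l.+1 = residues l'.+1.
Proof.
move=> eq_ll'; apply/ffunP => f; rewrite !ffunE; congr (inord `|_|).
rewrite !walk_sumS; case: ifP => // _.
apply/eqP; rewrite eqz_mod_dvd -sumrB; apply: rpred_sum => i _.
rewrite -mulrBr dvdz_mull // -eqz_mod_dvd; exact/eqP/residuesP.
Qed.

End Residues.

Theorem theorem3p1 (k m u : nat) (hk : (2 <= k)%N) (hm : (0 < m)%N)
    (hu : (0 < u)%N) (b c : nat -> int) :
  eventually_periodic (fun n : nat => (Chat b c k u n %% m%:Z)%Z).
Proof.
case: k hk => [|[|k]] // _; case: m hm => [|m] // _.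
have [N [p [p_gt0 perN]]] :=
  eventually_periodic_finite (@residuesS b c k u m).
(* Raising the index of [Chat] by [p] lengthens the walks by [k.+2 * p], that is, by [k.+2]
   periods. *)
have per q n : (N <= n)%N ->
    residues b c k u m (n + q * p) = residues b c k u m n.
  move=> le_Nn; elim: q => [|q IHq]; first by rewrite addn0.
  have -> : (n + q.+1 * p = n + q * p + p)%N by lia.
  by rewrite perN ?IHq // (leq_trans le_Nn) // leq_addr.
exists N, p; split=> // n le_Nn; rewrite !Chat_walk_sum mulnDr.
by apply: residuesP; apply: per; nia.
Qed.
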